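(* Let $G=\mathrm{Sz}(2^{2n+1})$ be the Suzuki group with $n\geq 1$, and let $\mathcal{C}$ be a conjugacy class of elements of order four in $G$. Then $K_{\mathcal{C}}$ is irreducible.
   Context: For a finite group $G$ and a subset $\mathcal{C}\subseteq G\setminus\{1\}$ closed under conjugation, the Killing form $K_{\mathcal{C}}$ is the bilinear form on the complex vector space with basis $\mathcal{C}$ given on basis elements by $K_{\mathcal{C}}(a,b)=|C_G(ab)\cap\mathcal{C}|$. $K_{\mathcal{C}}$ is irreducible if the graph with vertex set $\mathcal{C}$, in which distinct $a,b$ are adjacent iff $C_G(ab)\cap\mathcal{C}\neq\emptyset$, is connected, and reducible otherwise. *)

(* Defs.v *)
From HB Require Import structures.
From mathcomp Require Import all_boot all_order all_algebra all_fingroup all_field.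
Set Implicit Arguments. Unset Strict Implicit. Unset Printing Implicit Defensive.
Import GRing.Theory.
Local Open Scope ring_scope.

Definition killing_adj (gT : finGroupType) (G C : {set gT}) : rel gT :=
  fun a b => [&& a \in C, b \in C, a != b & ('C_G[a * b]%g :&: C) != set0].

Definition killing_irreducible (gT : finGroupType) (G C : {set gT}) : Prop :=
  {in C &, forall a b, connect (killing_adj G C) a b}.

(* F is a finite field with 2^(2n+1) elements; sigma x = x^(2^(n+1)),
   so that sigma (sigma x) = x^2. *)
Section Suzuki.
Variables (F : finFieldType) (n : nat).

Definition sz_sigma (x : F) : F := x ^+ (2 ^ n.+1).

Definition mx_of_rows (r : seq (seq F)) : 'M[F]_4 :=
  \matrix_(i < 4, j < 4) nth 0 (nth [::] r i) j.

Definition sz_T (a b : F) : 'M[F]_4 :=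
  mx_of_rows
    [:: [:: 1; 0; 0; 0];
        [:: a; 1; 0; 0];
        [:: b; sz_sigma a; 1; 0];
        [:: a ^+ 2 * sz_sigma a + a * b + sz_sigma b; a * sz_sigma a + b; a; 1]].

Definition sz_D (k : F) : 'M[F]_4 :=
  mx_of_rows
    [:: [:: k ^+ (2 ^ n).+1; 0; 0; 0];
        [:: 0; k ^+ (2 ^ n); 0; 0];
        [:: 0; 0; k^-1 ^+ (2 ^ n); 0];
        [:: 0; 0; 0; k^-1 ^+ (2 ^ n).+1]].

Definition sz_W : 'M[F]_4 :=
  mx_of_rows [:: [:: 0; 0; 0; 1]; [:: 0; 0; 1; 0]; [:: 0; 1; 0; 0]; [:: 1; 0; 0; 0]].

Definition to_GL (M : 'M[F]_4) : {'GL_4[F]} := insubd (1%g : {'GL_4[F]}) M.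

Definition sz_gens : {set {'GL_4[F]}} :=
  [set to_GL (sz_T ab.1 ab.2) | ab in [set: F * F]]
  :|: [set to_GL (sz_D k) | k in [set k : F | k != 0]]
  :|: [set to_GL sz_W].

Definition Suzuki : {group {'GL_4[F]}} := <<sz_gens>>%G.

End Suzuki.

(* Main.v *)
Require Import Defs.
From HB Require Import structures.
From mathcomp Require Import all_boot all_order all_algebra all_fingroup.
From mathcomp Require Import all_solvable all_field.
From mathcomp Require Import ring.

(* Let S = {T(a,b)} and B = S D. The Bruhat decomposition G = B u BwS makes S a
   Sylow 2-subgroup, so x is conjugate to some T(a,b) with a != 0, and then,
   by additive Hilbert 90 for sigma, to u = T(1,0) or to its inverse T(1,1).
   The elements of G mapping u into its own connected component form a group,
   so it is enough to join u to u^g for every generator g of G.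
   If g is in S or D then u u^g is in S, where it commutes with u or is itself
   conjugate to u or u^-1. If g = w then u and w lie in the Frobenius group
   Sz(2) of order 20, where u u^w is an involution, hence the square of a
   conjugate of u. *)

Set Implicit Arguments. Unset Strict Implicit. Unset Printing Implicit Defensive.
Import GRing.Theory.
Local Open Scope ring_scope.

(** * Connectedness of a class tested on a generating set *)

(** Conjugation by [G] acts on the graph by automorphisms, so the [k] with [u ^ k] in the component
    of [u] form a subgroup. For [g] in [A], either [u ^ g] is [u] or the two are adjacent, with
    [u ^ p] as the element centralizing the product. *)
Lemma killing_irreducible_of_gens (gT : finGroupType) (G : {group gT})
    (A : {set gT}) (u : gT) :
  A \subset G -> G \subset <<A>>%g -> u \in G ->
  {in A, forall g, exists2 p, p \in G & commute (u ^ p)%g (u * u ^ g)%g} ->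
  killing_irreducible G (u ^: G)%g.
Proof.
move=> sAG sGA uG hA; set C := (u ^: G)%g; set e := killing_adj G C.
have CJ c k : k \in G -> ((c ^ k)%g \in C) = (c \in C).
  by move=> kG; rewrite /C class_sym classGidl // class_sym.
have CG c : c \in C -> c \in G by case/imsetP => k kG ->; rewrite groupJ.
have adjP a b : reflect [/\ a \in C, b \in C, a != b &
    exists2 z, z \in C & commute z (a * b)%g] (e a b).
  apply: (iffP and4P) => -[aC bC ab].
    case/set0Pn => z; rewrite !in_setI => /andP[/andP[_ /cent1P h] zC].
    by split=> //; exists z => //; apply: commute_sym.
  case=> z zC h; split=> //; apply/set0Pn; exists z.
  rewrite !in_setI zC CG //= andbT.
  by apply/cent1P; apply: commute_sym.
have commJ (x y k : gT) : commute x y -> commute (x ^ k)%g (y ^ k)%g.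
  by move=> h; rewrite /commute -!conjMg h.
have sym_e : connect_sym e.
  apply: sym_connect_sym.
  have one a b : e a b -> e b a.
    case/adjP => aC bC ab [z zC h]; apply/adjP; split; rewrite 1?eq_sym //.
    (* The product [b * a] is the conjugate of [a * b] by [a], so the witness is conjugated
       along. *)
    exists (z ^ a)%g; rewrite ?CJ ?CG //.
    have -> : (b * a = (a * b) ^ a)%g by rewrite conjgE !mulgA mulVg mul1g.
    exact: commJ.
  by move=> a b; apply/idP/idP; exact: one.
have eJ k : k \in G ->
    forall a b, connect e a b -> connect e (a ^ k)%g (b ^ k)%g.
  move=> kG a b /connectP[s].
  elim: s a => [|c s IHs] a /=; first by move=> _ ->.
  case/andP => /adjP[aC cC ac [z zC h]] pth eb.
  apply: connect_trans (IHs c pth eb); apply/connect1/adjP.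
  split; rewrite ?CJ ?(inj_eq (conjg_inj k)) //.
  by exists (z ^ k)%g; rewrite ?CJ // -conjMg; exact: commJ.
pose K := [set k in G | connect e u (u ^ k)%g].
have gK : group_set K.
  apply/group_setP; split; first by rewrite inE group1 conjg1 connect0.
  move=> k l; rewrite !inE => /andP[kG hk] /andP[lG hl]; rewrite groupM //=.
  (* Conjugating the path from [u] to [u ^ k] by [l] continues the path from [u] to [u ^ l]. *)
  by apply: connect_trans hl _; rewrite conjgM; exact: eJ.
have sGK : G \subset K.
  apply: subset_trans sGA _; rewrite -[K]/(gval (Group gK)) gen_subG.
  apply/subsetP => g gA; have gG := subsetP sAG g gA.
  rewrite inE gG /=; have [<-|nuy] := eqVneq u (u ^ g)%g; first exact: connect0.
  apply/connect1/adjP; split=> //; rewrite ?CJ ?class_refl //.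
  by have [p pG hp] := hA g gA; exists (u ^ p)%g; rewrite ?CJ ?class_refl.
have conn c : c \in C -> connect e u c.
  by case/imsetP => k /(subsetP sGK) + ->; rewrite inE => /andP[].
by move=> a b aC bC; apply: connect_trans (conn b bC); rewrite sym_e conn.
Qed.

Lemma commute_conj_of_conj (gT : finGroupType) (G : {group gT}) (u t g : gT) :
  g \in G -> commute u (t ^ g)%g -> exists2 p, p \in G & commute (u ^ p)%g t.
Proof.
move=> gG h; exists g^-1%g; rewrite ?groupV //.
by rewrite /commute -[t](conjgK g) -!conjMg h.
Qed.

(** * Relations of the Frobenius group of order 20 *)

Section FrobeniusTwenty.

Variables (gT : finGroupType) (G : {group gT}) (x w : gT).
Hypotheses (xG : x \in G) (wG : w \in G).
Hypotheses (x4 : (x ^+ 4 = 1)%g) (w2 : (w * w = 1)%g).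
Hypothesis rel1 : (w * x * w = x ^+ 2 * w * x)%g.
Hypothesis rel2 : (w * x ^+ 2 * w = x * w * x^-1)%g.
Hypothesis rel3 : (w * x^-1 * w = x^-1 * w * x ^+ 2)%g.

(** By [rel1] and [rel3], [u * u ^ w] is [w ^ x] or [w ^ (x ^+ 2)]; by [rel2], [w] is conjugate to
    [x ^+ 2]. So the product is a conjugate of [x ^+ 2] by some [g], and it commutes with
    [u ^ g]. *)
Lemma frobenius20_commute u : u = x \/ u = x^-1%g ->
  exists2 g, g \in G & commute (u ^ g)%g (u * u ^ w)%g.
Proof.
move=> uE.
have wV : (w^-1 = w)%g by apply: (mulgI w); rewrite mulgV.
have x2V : (x ^- 2 = x ^+ 2)%g.
  by apply: (mulgI (x ^+ 2)%g); rewrite mulgV -expgD.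
have x3 : (x * x ^+ 2 = x^-1)%g by apply: (mulgI x); rewrite mulgV -!expgS.
have x22 : (x^-1 * x^-1 = x ^+ 2)%g by rewrite -x2V expgS expg1 invMg.
have x2W : (x ^+ 2 = w ^ (x^-1 * w))%g.
  have -> : (w ^ (x^-1 * w) = w * (x * w * x^-1) * w)%g.
    by rewrite conjgE invMg wV invgK !mulgA.
  by rewrite -rel2 !mulgA w2 mul1g -(mulgA _ w w) w2 mulg1.
have [p pG ep] : exists2 p, p \in G & (u * u ^ w = w ^ p)%g.
  have -> : (u ^ w = w * u * w)%g by rewrite conjgE wV mulgA.
  case: uE => ->.
    by exists x => //; rewrite rel1 conjgE 2!(mulgA x) x3 mulgA.
  exists (x ^+ 2)%g; first exact: groupX.
  by rewrite rel3 conjgE x2V 2!(mulgA x^-1%g) x22 (mulgA (x ^+ 2)%g).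
exists ((x^-1 * w)^-1 * p)%g.
  by apply: groupM pG; apply/groupVr/groupM; first exact: groupVr.
have -> : (u * u ^ w = x ^+ 2 ^ ((x^-1 * w)^-1 * p))%g.
  by rewrite ep x2W -conjgM mulKVg.
rewrite /commute -!conjMg; congr (_ ^ _)%g.
by case: uE => ->; [|apply/commute_sym/commuteV/commute_sym]; exact: commuteX.
Qed.

End FrobeniusTwenty.

(** * Entrywise computation with four by four matrices *)

Lemma mulmx_rows (F : finFieldType)
  (a00 a01 a02 a03 a10 a11 a12 a13 a20 a21 a22 a23 a30 a31 a32 a33 : F)
  (b00 b01 b02 b03 b10 b11 b12 b13 b20 b21 b22 b23 b30 b31 b32 b33 : F) :
  mx_of_rows [:: [:: a00; a01; a02; a03]; [:: a10; a11; a12; a13];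
                 [:: a20; a21; a22; a23]; [:: a30; a31; a32; a33]] *m
  mx_of_rows [:: [:: b00; b01; b02; b03]; [:: b10; b11; b12; b13];
                 [:: b20; b21; b22; b23]; [:: b30; b31; b32; b33]] =
  mx_of_rows
   [:: [:: a00 * b00 + a01 * b10 + a02 * b20 + a03 * b30;
           a00 * b01 + a01 * b11 + a02 * b21 + a03 * b31;
           a00 * b02 + a01 * b12 + a02 * b22 + a03 * b32;
           a00 * b03 + a01 * b13 + a02 * b23 + a03 * b33];
       [:: a10 * b00 + a11 * b10 + a12 * b20 + a13 * b30;
           a10 * b01 + a11 * b11 + a12 * b21 + a13 * b31;
           a10 * b02 + a11 * b12 + a12 * b22 + a13 * b32;
           a10 * b03 + a11 * b13 + a12 * b23 + a13 * b33];
       [:: a20 * b00 + a21 * b10 + a22 * b20 + a23 * b30;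
           a20 * b01 + a21 * b11 + a22 * b21 + a23 * b31;
           a20 * b02 + a21 * b12 + a22 * b22 + a23 * b32;
           a20 * b03 + a21 * b13 + a22 * b23 + a23 * b33];
       [:: a30 * b00 + a31 * b10 + a32 * b20 + a33 * b30;
           a30 * b01 + a31 * b11 + a32 * b21 + a33 * b31;
           a30 * b02 + a31 * b12 + a32 * b22 + a33 * b32;
           a30 * b03 + a31 * b13 + a32 * b23 + a33 * b33]].
Proof.
apply/matrixP => i j; rewrite !mxE !big_ord_recl big_ord0 !mxE /= !addrA addr0.
by case: i j => [] [|[|[|[|//]]]] ? [] [|[|[|[|//]]]].
Qed.

Lemma eq_mx_of_rows (F : finFieldType)
  (a00 a01 a02 a03 a10 a11 a12 a13 a20 a21 a22 a23 a30 a31 a32 a33 : F)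
  (b00 b01 b02 b03 b10 b11 b12 b13 b20 b21 b22 b23 b30 b31 b32 b33 : F) :
  a00 = b00 -> a01 = b01 -> a02 = b02 -> a03 = b03 ->
  a10 = b10 -> a11 = b11 -> a12 = b12 -> a13 = b13 ->
  a20 = b20 -> a21 = b21 -> a22 = b22 -> a23 = b23 ->
  a30 = b30 -> a31 = b31 -> a32 = b32 -> a33 = b33 ->
  mx_of_rows [:: [:: a00; a01; a02; a03]; [:: a10; a11; a12; a13];
                 [:: a20; a21; a22; a23]; [:: a30; a31; a32; a33]] =
  mx_of_rows [:: [:: b00; b01; b02; b03]; [:: b10; b11; b12; b13];
                 [:: b20; b21; b22; b23]; [:: b30; b31; b32; b33]].
Proof. by do 16!move=> ->. Qed.

Section Suzuki.

Variables (F : finFieldType) (n : nat).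
Hypothesis cardF : #|F| = (2 ^ (2 * n).+1)%N.

Local Notation sg := (@sz_sigma F n).
Local Notation T := (@sz_T F n).
Local Notation D := (@sz_D F n).
Local Notation W := (@sz_W F).

(** * Characteristic two and the automorphism sigma *)

Lemma pchar2 : 2 \in [pchar F].
Proof. exact: card_finPcharP cardF _. Qed.

Lemma two_eq0 : 2%:R = 0 :> F.
Proof. exact: pcharf0 pchar2. Qed.

Lemma natr_odd m : m%:R = (odd m)%:R :> F.
Proof.
by rewrite -{1}(odd_double_half m) natrD -mul2n natrM two_eq0 mul0r addr0.
Qed.

(* [ring] and [field] ignore the characteristic, so the numerals that occur as
   coefficients are supplied with their parities. *)
Let par2 : 2%:R = 0 :> F := natr_odd 2.
Let par3 : 3%:R = 1 :> F := natr_odd 3.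
Let par4 : 4%:R = 0 :> F := natr_odd 4.
Let par5 : 5%:R = 1 :> F := natr_odd 5.
Let par6 : 6%:R = 0 :> F := natr_odd 6.
Let par7 : 7%:R = 1 :> F := natr_odd 7.
Let par8 : 8%:R = 0 :> F := natr_odd 8.
Let par9 : 9%:R = 1 :> F := natr_odd 9.
Let par10 : 10%:R = 0 :> F := natr_odd 10.
Ltac ring2 := ring: par2 par3 par4 par5 par6 par7 par8 par9 par10.

Lemma sgD a b : sg (a + b) = sg a + sg b.
Proof.
rewrite /sz_sigma exprDn_pchar // (eq_pnat _ (pcharf_eq pchar2)).
by rewrite pnatX pnat_id.
Qed.

Lemma sgM a b : sg (a * b) = sg a * sg b.
Proof. exact: exprMn. Qed.

Lemma sgV a : sg a^-1 = (sg a)^-1.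
Proof. exact: exprVn. Qed.

Lemma sgX a m : sg (a ^+ m) = sg a ^+ m.
Proof. by rewrite /sz_sigma exprAC. Qed.

Lemma sg0 : sg 0 = 0 :> F.
Proof. by rewrite /sz_sigma expr0n expn_eq0. Qed.

Lemma sg1 : sg 1 = 1 :> F.
Proof. exact: expr1n. Qed.

Lemma sg_eq0 a : (sg a == 0) = (a == 0).
Proof. by rewrite expf_eq0 expn_gt0. Qed.

Lemma sgK a : sg (sg a) = a ^+ 2.
Proof.
rewrite /sz_sigma -exprM -expnD -[RHS]expf_card cardF -exprM -expnS.
by congr (_ ^+ (2 ^ _)); rewrite addSn addnS mul2n addnn.
Qed.

(** As 2^(n+1) * 2^n is the order of [F], the power 2^n inverts sigma. *)
Lemma sg_half a : sg a ^+ (2 ^ n) = a.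
Proof.
rewrite /sz_sigma -exprM -expnD -[RHS]expf_card cardF.
by congr (_ ^+ (2 ^ _)); rewrite addSn mul2n addnn.
Qed.

Lemma half_sqr a : (a ^+ (2 ^ n)) ^+ 2 = sg a.
Proof. by rewrite -exprM -expnSr. Qed.

Lemma sg_half_sg a : sg (a ^+ (2 ^ n)) = a.
Proof. by rewrite sgX sg_half. Qed.

Lemma sg_fix a : sg a = a -> a = 0 \/ a = 1.
Proof.
move=> ha; have := sgK a; rewrite !ha => /eqP.
rewrite -subr_eq0 -{1}[a]mulr1 expr2 -mulrBr mulf_eq0 subr_eq0.
by case/orP => [/eqP|/eqP <-]; [left|right].
Qed.

(* The lower left entry of [sz_T n a b]. *)
Definition sz_f (a b : F) : F := a ^+ 2 * sg a + a * b + sg b.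

(** For nonzero [a], put [b = a * sg a * d]: the value becomes [a ^+ 2 * sg a * (1 + d + sg d)]. If
    it vanishes, [sg d = d + 1]; applying sigma again gives [d ^+ 2 = d], so [d] is 0 or 1 and is
    fixed by sigma, a contradiction. *)
Lemma sz_f_eq0 a b : sz_f a b = 0 -> a = 0 /\ b = 0.
Proof.
rewrite /sz_f; have [->|a0] := eqVneq a 0.
  by rewrite expr0n !mul0r !add0r => /eqP; rewrite sg_eq0 => /eqP.
have s0 : sg a != 0 by rewrite sg_eq0.
have [d ->] : exists d, b = a * sg a * d.
  by exists (b / (a * sg a)); field; rewrite a0 s0.
rewrite !sgM sgK => h.
have hd : sg d = d + 1.
  have : a ^+ 2 * sg a * (1 + d + sg d) = 0 by rewrite -h; ring.
  move/eqP; rewrite !mulf_eq0 (negPf s0) (negPf a0) /= => /eqP h1.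
  by rewrite -[RHS]addr0 -h1; ring2.
have hd2 : d ^+ 2 = d by rewrite -sgK hd sgD hd sg1; ring2.
have : d * (d - 1) = 0 by rewrite mulrBr -expr2 hd2 mulr1 subrr.
move/eqP; rewrite mulf_eq0 subr_eq0 => /orP[] /eqP hd'; move: hd; rewrite hd'.
  by rewrite sg0 add0r => /eqP; rewrite eq_sym oner_eq0.
by rewrite sg1 -(natrD _ 1 1) two_eq0 => /eqP; rewrite oner_eq0.
Qed.

(** * Matrix identities between the generators *)

Lemma sz_TM a b c d : T a b *m T c d = T (a + c) (b + d + sg a * c).
Proof.
rewrite mulmx_rows; apply: eq_mx_of_rows; rewrite ?sgD ?sgM ?sgK; ring2.
Qed.

Lemma sz_DM k l : D k *m D l = D (k * l).
Proof.
by rewrite mulmx_rows; apply: eq_mx_of_rows;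
  rewrite ?(mulr0, mul0r, addr0, add0r) ?invfM ?exprMn.
Qed.

Lemma sz_WM : W *m W = 1.
Proof.
rewrite mulmx_rows; apply/matrixP => i j; rewrite !mxE.
by case: i j => [] [|[|[|[|//]]]] ? [] [|[|[|[|//]]]] ?;
   rewrite /= ?(mulr0, mul0r, addr0, add0r, mulr1).
Qed.

Lemma sz_WD k : D k *m W = W *m D k^-1.
Proof.
by rewrite !mulmx_rows; apply: eq_mx_of_rows;
  rewrite ?invrK ?(mulr0, mul0r, addr0, add0r, mulr1, mul1r).
Qed.

Lemma sz_TD a b k : k != 0 -> T a b *m D k = D k *m T (a * k) (b * (k * sg k)).
Proof.
move=> k0; rewrite !mulmx_rows.
(* With [h = k ^+ (2 ^ n)] one has [sg k = h ^+ 2], so all entries become rational in [h] and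
   [k]. *)
rewrite !exprS !sgM sgK -(half_sqr k).
set h := k ^+ (2 ^ n); rewrite exprVn -/h.
have h0 : h != 0 by rewrite expf_eq0 (negPf k0) andbF.
by apply: eq_mx_of_rows; field; rewrite ?h0 ?k0.
Qed.

Lemma sz_W_T_W a b : sz_f a b != 0 ->
  exists a1 b1 k a2 b2,
  k != 0 /\ W *m T a b *m W *m T a2 b2 = T a1 b1 *m D k *m W.
Proof.
(* f, g and c are kept opaque so that the coefficients met by [field] stay
   within reach of the parity equations. *)
have [f Ef] : {f | f = sz_f a b} by eexists.
have [g Eg0] : {g | sg f = g} by eexists.
rewrite -Ef => f0.
have g0 : g != 0 by rewrite -Eg0 sg_eq0.
have [c Ec] : {c | c = (a * sg a + b) / f} by eexists.
(* The witnesses are forced: the top row gives [a2] and [b2], the last column gives [a1] and [b1],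
   and the top right corner gives [k ^+ (2 ^ n).+1 = f], hence [k = f ^+ 2 / sg f]. *)
exists (b / f), (a / f), (f ^+ 2 / g), c, (a / f).
split; first by rewrite mulf_neq0 ?invr_eq0 ?expf_neq0.
have -> : D (f ^+ 2 / g) = mx_of_rows
    [:: [:: f; 0; 0; 0]; [:: 0; g / f; 0; 0];
        [:: 0; 0; f / g; 0]; [:: 0; 0; 0; f^-1]].
  have h : (f ^+ 2 / g) ^+ (2 ^ n) = g / f.
    by rewrite -Eg0 exprMn exprVn sg_half exprAC half_sqr.
  have h1 : (f ^+ 2 / g) ^+ (2 ^ n).+1 = f.
    by rewrite exprS h; field; rewrite f0 g0.
  by apply: eq_mx_of_rows; rewrite ?exprVn ?h1 ?h ?invf_div.
have Eg : g = sg a ^+ 2 * a ^+ 2 + sg a * sg b + b ^+ 2.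
  by rewrite -Eg0 Ef /sz_f !(sgD, sgM, sgX, sgK); ring.
have Esc : sg c = (sg a * a ^+ 2 + sg b) / g.
  by rewrite Ec !(sgM, sgV, sgD, sgK) Eg0.
have sV x : sg (x / f) = sg x / g by rewrite sgM sgV Eg0.
rewrite !mulmx_rows Esc !sV.
clear Esc sV Eg0; rewrite /sz_f in Ef.
move: (sg a) (sg b) Eg Ef Ec => s t Eg Ef Ec.
(* This and the next identity say that both outer factors [T] have lower left entry [f^-1]. *)
have -> : (b / f) ^+ 2 * (t / g) + b / f * (a / f) + s / g = f^-1.
  transitivity ((b ^+ 2 * t + a * b * g + s * f ^+ 2) / (f ^+ 2 * g)).
    by field; rewrite f0 g0.
  have -> : b ^+ 2 * t + a * b * g + s * f ^+ 2 = f * g by rewrite Eg Ef; ring2.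
  by field; rewrite f0 g0.
have -> : c ^+ 2 * ((s * a ^+ 2 + t) / g) + c * (a / f) + s / g = f^-1.
  rewrite Ec; transitivity (((a * s + b) ^+ 2 * (s * a ^+ 2 + t)
    + (a * s + b) * a * g + s * f ^+ 2) / (f ^+ 2 * g)).
    by field; rewrite f0 g0.
  have -> : (a * s + b) ^+ 2 * (s * a ^+ 2 + t) + (a * s + b) * a * g
    + s * f ^+ 2 = f * g by rewrite Eg Ef; ring2.
  by field; rewrite f0 g0.
have -> : c * ((s * a ^+ 2 + t) / g) + a / f = b / g.
  rewrite Ec; transitivity (((a * s + b) * (s * a ^+ 2 + t) + a * g) / (f * g)).
    by field; rewrite f0 g0.
  have -> : (a * s + b) * (s * a ^+ 2 + t) + a * g = b * f.
    by rewrite Eg Ef; ring2.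
  by field; rewrite f0 g0.
(* Solved for [t] and [g], the relations serve [field] as rewriting rules and leave [f] as a free
   denominator. *)
have Et : t = f + a ^+ 2 * s + a * b by rewrite Ef; ring2.
have Eg' : g = s * f + s * a * b + b ^+ 2 by rewrite Eg Ef; ring2.
rewrite Ec; clear Ec c Eg Ef.
by apply: eq_mx_of_rows;
  field: Et Eg' par2 par3 par4 par5 par6 par7 par8 par9 par10;
  rewrite ?f0 ?g0.
Qed.

(** * The generators as elements of the general linear group *)

Local Notation G := (Suzuki F n).

(* With this cast the group operations are inferred from the finGroupType
   structure, as in general group lemmas; comparing them with the operations
   inferred from {'GL_4[F]} itself is very slow. *)
Local Notation GL4 := ({'GL_4[F]} : finGroupType).

(* Locked, as unification would otherwise unfold the matrices. *)
Definition glT a b : GL4 := locked (to_GL (T a b)).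
Definition glD k : GL4 := locked (to_GL (D k)).
Definition glW : GL4 := locked (to_GL W).

Lemma to_GLK (M : 'M[F]_4) : M \in unitmx -> GLval (to_GL M) = M.
Proof. by move=> uM; exact: insubdK. Qed.

Lemma GLval_inj : injective (@GLval 4 F).
Proof. exact: val_inj. Qed.

Lemma sz_T00 : T 0 0 = 1%:M.
Proof.
rewrite /sz_T sg0; apply/matrixP => i j; rewrite !mxE.
by case: i j => [] [|[|[|[|//]]]] ? [] [|[|[|[|//]]]] ?;
   rewrite /= ?(mulr0, mul0r, addr0, expr0n).
Qed.

Lemma sz_D1 : D 1 = 1%:M.
Proof.
rewrite /sz_D invr1 !expr1n; apply/matrixP => i j; rewrite !mxE.
by case: i j => [] [|[|[|[|//]]]] ? [] [|[|[|[|//]]]].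
Qed.

Lemma unit_T a b : T a b \in unitmx.
Proof.
have: T a b *m T a (b + sg a * a) = 1%:M.
  by rewrite sz_TM -sz_T00; congr T; ring2.
by case/mulmx1_unit.
Qed.

Lemma unit_D k : k != 0 -> D k \in unitmx.
Proof.
move=> k0; have: D k *m D k^-1 = 1%:M by rewrite sz_DM mulfV // sz_D1.
by case/mulmx1_unit.
Qed.

Lemma unit_W : W \in unitmx.
Proof. by case/mulmx1_unit: sz_WM. Qed.

Lemma glTE a b : GLval (glT a b) = T a b.
Proof. by rewrite /glT -lock; exact/to_GLK/unit_T. Qed.

Lemma glDE k : k != 0 -> GLval (glD k) = D k.
Proof. by move=> k0; rewrite /glD -lock; exact/to_GLK/unit_D. Qed.

Lemma glWE : GLval glW = W.
Proof. by rewrite /glW -lock; exact/to_GLK/unit_W. Qed.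

Lemma glTM a b c d : (glT a b * glT c d)%g = glT (a + c) (b + d + sg a * c).
Proof. by apply: GLval_inj; rewrite GL_MxE !glTE sz_TM. Qed.

Lemma glT00 : glT 0 0 = 1%g.
Proof. by apply: GLval_inj; rewrite glTE sz_T00. Qed.

Lemma glTV a b : (glT a b)^-1%g = glT a (b + sg a * a).
Proof.
apply: (mulgI (glT a b)); rewrite mulgV glTM -glT00; congr glT; ring2.
Qed.

Lemma glDM k l : k != 0 -> l != 0 -> (glD k * glD l)%g = glD (k * l).
Proof.
move=> k0 l0; apply: GLval_inj.
by rewrite GL_MxE !glDE ?mulf_neq0 // sz_DM.
Qed.

Lemma glD1 : glD 1 = 1%g.
Proof. by apply: GLval_inj; rewrite glDE ?oner_eq0 // sz_D1. Qed.

Lemma glWW : (glW * glW)%g = 1%g.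
Proof. by apply: GLval_inj; rewrite GL_MxE glWE sz_WM. Qed.

Lemma glWV : (glW^-1)%g = glW.
Proof. by apply: (mulgI glW); rewrite mulgV glWW. Qed.

Lemma glWD k : k != 0 -> (glW * glD k)%g = (glD k^-1%R * glW)%g.
Proof.
move=> k0; apply: GLval_inj; rewrite !GL_MxE glWE !glDE ?invr_eq0 //.
by rewrite (sz_WD k^-1) invrK.
Qed.

Lemma glTD a b k : k != 0 -> (glT a b ^ glD k)%g = glT (a * k) (b * (k * sg k)).
Proof.
move=> k0; apply: (mulgI (glD k)); rewrite -conjgC; apply: GLval_inj.
by rewrite !GL_MxE !glTE glDE // sz_TD.
Qed.

Lemma glTJ a b c : (glT a b ^ glT c 0)%g = glT a (b + sg a * c + sg c * a).
Proof.
apply: (mulgI (glT c 0)); rewrite -conjgC !glTM; congr glT.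
  by rewrite addrC.
ring2.
Qed.

Lemma glW_T_W a b : (a, b) != (0, 0) ->
  exists a1 b1 k a2 b2,
  k != 0 /\ (glW * glT a b * glW = glT a1 b1 * glD k * glW * glT a2 b2)%g.
Proof.
move=> ab0; have f0: sz_f a b != 0.
  by apply: contraNneq ab0 => /sz_f_eq0 [-> ->].
have [a1 [b1 [k [a2 [b2 [k0 h]]]]]] := sz_W_T_W f0.
exists a1, b1, k, a2, (b2 + sg a2 * a2); split => //.
apply: (canRL (mulgKV _)); rewrite glTV.
have -> : b2 + sg a2 * a2 + sg a2 * a2 = b2 by ring2.
by apply: GLval_inj; rewrite !GL_MxE !glTE glWE glDE.
Qed.

Lemma gen_T a b : glT a b \in G.
Proof.
apply: mem_gen; rewrite !inE; apply/orP; left; apply/orP; left.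
by apply/imsetP; exists (a, b); rewrite // /glT -lock.
Qed.

Lemma gen_D k : k != 0 -> glD k \in G.
Proof.
move=> k0; apply: mem_gen; rewrite !inE; apply/orP; left; apply/orP; right.
by apply/imsetP; exists k; rewrite ?inE // /glD -lock.
Qed.

Lemma gen_W : glW \in G.
Proof. by apply: mem_gen; rewrite !inE /glW -lock eqxx orbT. Qed.

Lemma sz_gensP g : g \in sz_gens F n ->
  [\/ exists a b, g = glT a b, exists2 k, k != 0 & g = glD k | g = glW].
Proof.
rewrite !inE /glT /glD /glW -!lock => /orP[/orP[]|/eqP ->].
- by case/imsetP => -[a b] _ ->; constructor 1; exists a, b; rewrite -lock.
- case/imsetP => k; rewrite inE => k0 ->.
  by constructor 2; exists k; rewrite -?lock.
by constructor 3.
Qed.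

(** * The Borel subgroup and the Bruhat decomposition *)

Definition sz_S : {set GL4} := [set glT ab.1 ab.2 | ab in [set: F * F]].
Definition sz_H : {set GL4} := [set glD k | k in [set k : F | k != 0]].

Lemma mem_S a b : glT a b \in sz_S.
Proof. by apply/imsetP; exists (a, b). Qed.

Lemma mem_H k : k != 0 -> glD k \in sz_H.
Proof. by move=> k0; apply/imsetP; exists k; rewrite ?inE. Qed.

Lemma group_set_S : group_set sz_S.
Proof.
apply/group_setP; split; first by rewrite -glT00 mem_S.
by move=> _ _ /imsetP[x _ ->] /imsetP[y _ ->]; rewrite glTM mem_S.
Qed.
Canonical sz_S_group := Group group_set_S.

Lemma group_set_H : group_set sz_H.
Proof.
apply/group_setP; split; first by rewrite -glD1 mem_H ?oner_eq0.
move=> _ _ /imsetP[x + ->] /imsetP[y + ->]; rewrite !inE => x0 y0.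
by rewrite glDM ?mem_H ?mulf_neq0.
Qed.
Canonical sz_H_group := Group group_set_H.

Lemma norm_S_H : sz_H \subset 'N(sz_S)%g.
Proof.
apply/subsetP => _ /imsetP[k + ->]; rewrite !inE => k0.
by apply/subsetP => _ /imsetP[_ /imsetP[ab _ ->] ->]; rewrite glTD ?mem_S.
Qed.

Local Notation S := sz_S_group.
Local Notation H := sz_H_group.
Local Notation B := (S <*> H)%G.

Lemma sz_BE : B = (S * H)%g :> {set _}.
Proof. exact: norm_joinEr norm_S_H. Qed.

Lemma sub_S_B : S \subset B.
Proof. exact: joing_subl. Qed.

Lemma mem_B_D k : k != 0 -> glD k \in B.
Proof. by move=> k0; rewrite (subsetP (joing_subr _ _)) ?mem_H. Qed.

Lemma mem_B_T a b : glT a b \in B.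
Proof. by rewrite (subsetP sub_S_B) ?mem_S. Qed.

Lemma sub_S_G : S \subset G.
Proof. by apply/subsetP => _ /imsetP[ab _ ->]; exact: gen_T. Qed.

Lemma sub_B_G : B \subset G.
Proof.
rewrite join_subG sub_S_G; apply/subsetP => _ /imsetP[k + ->].
by rewrite inE; exact: gen_D.
Qed.

(** [B] consists of lower triangular matrices; this one entry suffices to recognize elements outside
    [B]. *)
Lemma sz_B03 g : g \in B -> GLval g ord0 ord_max = 0.
Proof.
rewrite sz_BE => /mulsgP[_ _ /imsetP[ab _ ->] /imsetP[k + ->] ->].
rewrite inE => k0; rewrite GL_MxE glTE glDE // mulmx_rows !mxE /=.
by rewrite !(mulr0, mul0r, addr0).
Qed.

Lemma W_notin_B : glW \notin B.
Proof.
by apply/negP => /sz_B03; rewrite glWE !mxE /= => /eqP; rewrite oner_eq0.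
Qed.

(** By induction on words, the union is stable under right multiplication by each generator. The
    essential case is [glW] applied to the big cell, settled by [glW_T_W]. *)
Lemma sz_bruhat : G = B :|: (B :* glW * S)%g :> {set _}.
Proof.
apply/eqP; rewrite eqEsubset subUset sub_B_G andbC.
rewrite mul_subG ?sub_S_G ?mul_subG ?sub_B_G ?sub1set ?gen_W //=.
apply/subsetP => g /gen_prodgP[m [c Hc ->]] {g}.
elim: m c Hc => [|m IHm] c Hc; first by rewrite big_ord0 inE group1.
rewrite big_ord_recr /=; set g := (\prod_(i < m) _)%g.
have: g \in B :|: (B :* glW * S)%g by apply: IHm => i; exact: Hc.
move: g (Hc ord_max) => g /sz_gensP; move: (c _) => h.
have BwS b a a' : b \in B -> (b * glW * glT a a')%g \in (B :* glW * S)%g.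
  by move=> bB; rewrite mem_mulg ?mem_S ?mem_rcoset ?mulgK.
rewrite !inE => hh /orP[gB|/mulsgP[g1 _ + /imsetP[[a a'] _ ->] ->]].
  case: hh => [[a [b ->]]|[k k0 ->]|->].
  - by rewrite groupM ?mem_B_T.
  - by rewrite groupM ?mem_B_D.
  by rewrite -[(_ * _)%g]mulg1 -glT00 BwS ?orbT.
case/rcosetP => b bB -> {g1 g}.
case: hh => [[c1 [c2 ->]]|[k k0 ->]|->].
- by rewrite -mulgA glTM BwS ?orbT.
- rewrite -mulgA (conjgC (glT a a')) glTD // mulgA -[(b * _ * _)%g]mulgA.
  rewrite glWD // mulgA BwS ?orbT //.
  by rewrite groupM ?mem_B_D ?invr_eq0.
have [[-> ->]|ab0] := eqVneq (a, a') (0, 0).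
  by rewrite glT00 mulg1 -mulgA glWW mulg1 bB.
have [a1 [b1 [k [a2 [b2 [k0 e]]]]]] := glW_T_W ab0.
rewrite -!mulgA (mulgA glW) e !mulgA BwS ?orbT //.
by rewrite !groupM ?mem_B_T ?mem_B_D.
Qed.

(** * Orders and indices: [S] is a Sylow 2-subgroup *)

Lemma glT_inj a b c d : glT a b = glT c d -> a = c /\ b = d.
Proof.
move/(congr1 (@GLval 4 F)); rewrite !glTE => /matrixP h; split.
  by move: (h (inord 1) ord0); rewrite !mxE /= inordK.
by move: (h (inord 2) ord0); rewrite !mxE /= inordK.
Qed.

Lemma glD_inj k l : k != 0 -> l != 0 -> glD k = glD l -> k = l.
Proof.
move=> k0 l0 /(congr1 (@GLval 4 F)); rewrite !glDE // => /matrixP h.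
have := h (inord 1) (inord 1); rewrite !mxE /= !inordK //= => h1.
by rewrite -(sg_half_sg k) h1 sg_half_sg.
Qed.

Lemma card_S : #|S| = (#|F| ^ 2)%N.
Proof.
rewrite card_imset ?cardsT ?card_prod ?expnS ?expn1 ?muln1 //.
by move=> [a b] [c d] /= /glT_inj [-> ->].
Qed.

Lemma odd_card_H : odd #|H|.
Proof.
rewrite card_in_imset.
  have -> : [set k : F | k != 0] = ~: [set 0].
    by apply/setP => k; rewrite !inE.
  rewrite cardsC1 cardF expnS mul2n -(@prednK (2 ^ (2 * n))) ?expn_gt0 //.
  by rewrite doubleS /= odd_double.
move=> k l; rewrite !inE; exact: glD_inj.
Qed.

Lemma odd_index_B_S : odd #|B : S|%g.
Proof.
have h : (#|B : S|%g * #|S :&: H| = #|H|)%N.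
  apply/eqP; rewrite -(eqn_pmul2l (cardG_gt0 S)) mulnA Lagrange ?joing_subl //.
  by rewrite sz_BE; apply/eqP; rewrite -mul_cardG.
by move: odd_card_H; rewrite -h oddM => /andP[].
Qed.

Lemma pgroup_S : (2.-group S)%g.
Proof. by rewrite /pgroup card_S cardF -expnM pnatX pnat_id ?orTb. Qed.

(** The index is [1 + m], the big cell having [#|B| * m] elements. Here [m] divides the order of a
    2-group, and it is not 1 because conjugating [glT 0 1] by [glW] gives top right entry 1. *)
Lemma odd_index_G_B : odd #|G : B|%g.
Proof.
pose m := #|S : (B :^ glW)%G :&: S|%g.
have m2 : ~~ odd m.
  have: 2%N.-nat m by apply: pnat_dvd pgroup_S; exact: dvdn_indexg.
  case/p_natP => -[|k] em; last by rewrite em oddX.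
  move/eqP: em; rewrite expn0 indexg_eq1 subsetI => /andP[sSB _].
  have: glT 0 1 \in (B :^ glW)%g by apply: (subsetP sSB); exact: mem_S.
  rewrite mem_conjg glWV => /sz_B03.
  rewrite !GL_MxE glTE glWV glWE !mulmx_rows !mxE /=.
  rewrite !(mulr0, mul0r, addr0, add0r, mulr1, mul1r, expr0n) sg1 => /eqP.
  by rewrite oner_eq0.
have cBwS : #|(B :* glW * S)%g| = (#|B| * m)%N.
  have -> : (B :* glW * S)%g = (glW *: (B :^ glW * S))%g.
    by rewrite conjsgE !mulgA mulg_set1 mulgV mul1g.
  rewrite card_lcoset; apply/eqP.
  rewrite -(eqn_pmul2r (cardG_gt0 ((B :^ glW)%G :&: S))).
  by rewrite -mul_cardG cardJg -mulnA [(m * _)%N]mulnC Lagrange ?subsetIr.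
have dis : [disjoint B & (B :* glW * S)%g].
  apply/pred0P => g /=; apply/negP.
  case/andP => gB /mulsgP[_ s /rcosetP[b bB ->] sS e]; case/negP: W_notin_B.
  by rewrite -(groupMl _ bB) -(groupMr _ (subsetP sub_S_B _ sS)) -e.
have e : (#|G : B|%g = 1 + m)%N.
  apply/eqP; rewrite -(eqn_pmul2l (cardG_gt0 B)) Lagrange ?sub_B_G //.
  rewrite {1}sz_bruhat; move: dis; rewrite -leq_card_setU => /eqP ->.
  by rewrite cBwS mulnDr muln1.
by rewrite e oddD.
Qed.

Lemma Sylow_S : (2.-Sylow(G) S)%g.
Proof.
rewrite /pHall sub_S_G pgroup_S -odd_2'nat.
rewrite -(Lagrange_index sub_B_G) ?joing_subl // oddM odd_index_G_B.
by rewrite odd_index_B_S.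
Qed.

(** * Normal form of the elements of order four *)

(** Sylow's theorem moves [x] into [S], where [a = 0] would make its square trivial. *)
Lemma order4_conj_T x : x \in G -> #[x]%g = 4%N ->
  exists2 g, g \in G & exists a b, a != 0 /\ x = (glT a b ^ g)%g.
Proof.
move=> xG ox.
have px : (2.-group <[x]>)%g by rewrite /pgroup -orderE ox.
have sxG : (<[x]> \subset G)%g by rewrite cycle_subG.
have [g gG] := Hall_psubJ Sylow_S (isT : 2 \in (2%N : nat_pred)) sxG px.
rewrite cycle_subG => /imsetP[_ /imsetP[[a b] _ ->] /= e].
exists g => //; exists a, b; split => //.
apply/eqP => a0; have: (#[glT 0%R b]%g %| 2)%N.
  rewrite order_dvdn expgS expg1 glTM -glT00; apply/eqP.
  by congr glT; rewrite ?sg0; ring2.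
by rewrite -a0 -(orderJ _ g) -e ox.
Qed.

Lemma additive_Hilbert90 b : exists c, b + sg c + c = 0 \/ b + sg c + c = 1.
Proof.
(* With this [c], the sum [b + sg c + c] is the absolute trace of [b], hence fixed by sigma. The
   sums telescope because [sg (b ^+ (2 ^ n)) = b]. *)
pose c := \sum_(i < n) sg (b ^+ (2 ^ i)).
have sg_sum m (f : nat -> F) : sg (\sum_(i < m) f i) = \sum_(i < m) sg (f i).
  elim: m => [|m IHm]; first by rewrite !big_ord0 sg0.
  by rewrite !big_ord_recr /= sgD IHm.
exists c; apply: sg_fix.
have sc : sg c = \sum_(i < n) b ^+ (2 ^ i.+1).
  rewrite /c (sg_sum n (fun i => sg (b ^+ (2 ^ i)))).
  by apply: eq_bigr => i _; rewrite sgK -exprM expnSr.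
have ssc : sg (sg c) = \sum_(i < n) sg (b ^+ (2 ^ i.+1)).
  by rewrite sc (sg_sum n (fun i => b ^+ (2 ^ i.+1))).
have e : sg b + sg (sg c) = c + b.
  transitivity (\sum_(i < n.+1) sg (b ^+ (2 ^ i))).
    by rewrite big_ord_recl /= expr1 ssc.
  by rewrite big_ord_recr /= sg_half_sg.
by rewrite 2!sgD e; ring.
Qed.

Local Notation u0 := (glT 1 0).
Local Notation u1 := (glT 1 1).
Local Notation v := (glT 0 1).

(** Conjugation by [glD a^-1] normalizes the first parameter to 1; then [glT c 0] adds [sg c + c] to
    the second. *)
Lemma conj_T a b : a != 0 ->
  exists2 g, g \in G & (glT a b ^ g)%g = u0 \/ (glT a b ^ g)%g = u1.
Proof.
move=> a0; set b' := b * (a^-1 * sg a^-1).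
have [c hc] := additive_Hilbert90 b'.
exists (glD a^-1%R * glT c 0)%g.
  by apply: groupM; [apply: gen_D; rewrite invr_eq0|exact: gen_T].
rewrite conjgM glTD ?invr_eq0 // mulfV // glTJ sg1 mul1r mulr1 -/b' addrAC.
by case: hc => ->; [left|right].
Qed.

(** * The copy of Sz(2) generated by [u0] and [glW] *)

Lemma u0V : (u0^-1)%g = u1.
Proof. by rewrite glTV add0r sg1 mulr1. Qed.

(** With [x = u0], so that [x ^+ 2 = v] and [x^-1 = u1], this is [rel2]; the next two lemmas are
    [rel1] and [rel3]. *)
Lemma rel_01 : (glW * v * glW)%g = (u0 * glW * u1)%g.
Proof.
rewrite -u0V; apply: (canRL (mulgK _)); apply: GLval_inj.
rewrite !GL_MxE !glTE glWE !mulmx_rows !(sg0, sg1).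
by apply: eq_mx_of_rows; ring2.
Qed.

Lemma rel_u0 : (glW * u0 * glW)%g = (v * glW * u0)%g.
Proof.
rewrite -[u0 in RHS]invgK u0V; apply: (canRL (mulgK _)); apply: GLval_inj.
rewrite !GL_MxE !glTE glWE !mulmx_rows !(sg0, sg1).
by apply: eq_mx_of_rows; ring2.
Qed.

Lemma rel_u1 : (glW * u1 * glW)%g = (u1 * glW * v)%g.
Proof.
rewrite -[v in RHS]invgK; apply: (canRL (mulgK _)).
rewrite glTV sg0 mulr0 addr0; apply: GLval_inj.
rewrite !GL_MxE !glTE glWE !mulmx_rows !(sg0, sg1).
by apply: eq_mx_of_rows; ring2.
Qed.

Lemma u0_sqr : (u0 ^+ 2)%g = v.
Proof. by rewrite expgS expg1 glTM sg1 mulr1 !add0r; congr glT; ring2. Qed.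

Lemma u0_exp4 : (u0 ^+ 4)%g = 1%g.
Proof.
rewrite (expgM _ 2 2) u0_sqr expgS expg1 glTM -glT00 sg0 mul0r !addr0.
by congr glT; ring2.
Qed.

Lemma commute_W u : u = u0 \/ u = u1 ->
  exists2 g, g \in G & commute (u ^ g)%g (u * u ^ glW)%g.
Proof.
rewrite -u0V.
have := @frobenius20_commute _ G u0 glW (gen_T 1 0) gen_W u0_exp4 glWW.
by rewrite u0_sqr u0V => /(_ rel_u0 rel_01 rel_u1 u).
Qed.

(** * The commuting condition for all generators *)

(** For [a = 0] the element is central in [S]; otherwise it is conjugate to [u0] or to its inverse
    [u1], and both commute with [u]. *)
Lemma commute_S u a b : u = u0 \/ u = u1 ->
  exists2 g, g \in G & commute (u ^ g)%g (glT a b).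
Proof.
move=> uE; have [a0|a0] := eqVneq a 0.
  exists 1%g; first exact: group1.
  rewrite conjg1 a0; case: uE => ->;
  by rewrite /commute !glTM sg0 sg1; congr glT; ring.
have [g gG gT] := conj_T b a0.
apply: (@commute_conj_of_conj _ G u (glT a b) g gG).
have cV : commute u0 u1 by rewrite -u0V; exact: commuteV (commute_refl u0).
case: uE gT => -> [] ->.
- exact: commute_refl.
- exact: cV.
- exact: commute_sym.
exact: commute_refl.
Qed.

Lemma commute_gen u g : u = u0 \/ u = u1 -> g \in sz_gens F n ->
  exists2 p, p \in G & commute (u ^ p)%g (u * u ^ g)%g.
Proof.
move=> uE /sz_gensP gE.
have [a [b eu]] : exists a b, u = glT a b by case: uE => ->; do 2!eexists.
suff [gW|[c [d e]]] : g = glW \/ exists c d, (u * u ^ g)%g = glT c d.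
- by rewrite gW; exact: commute_W.
- by rewrite e; exact: commute_S.
case: gE => [[c [d ->]]|[k k0 ->]|]; last by left.
- by right; rewrite eu conjgE glTV !glTM; do 2!eexists.
by right; rewrite eu glTD // glTM; do 2!eexists.
Qed.

Lemma killing_irreducible_sz x : x \in G -> #[x]%g = 4%N ->
  killing_irreducible G (x ^: G)%g.
Proof.
move=> xG ox.
have [h hG [a [b [a0 ->]]]] := order4_conj_T xG ox.
have [g gG] := conj_T b a0.
(* Conjugates share their class, so the representative [x] may be replaced by [u0] or [u1]. *)
rewrite (@classGidl _ G (glT a b) h hG) -(@classGidl _ G (glT a b) g gG).
move: (_ ^ g)%g => u uE.
apply: (@killing_irreducible_of_gens _ G (sz_gens F n)).
- exact: subset_gen.
- exact: subxx.
- by case: uE => ->; exact: gen_T.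
by move=> p; exact: commute_gen.
Qed.

End Suzuki.

Theorem theorem5p3 (F : finFieldType) (n : nat) (x : {'GL_4[F]}) :
  (1 <= n)%N ->
  #|F| = (2 ^ (2 * n).+1)%N ->
  x \in Suzuki F n ->
  #[x]%g = 4%N ->
  killing_irreducible (Suzuki F n) (x ^: Suzuki F n)%g.
Proof. by move=> _ cardF; exact: killing_irreducible_sz. Qed.
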